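(* Let $X$ be an intrinsic net with a chosen spinor connection (a lifting of the Levi-Civita connection) and spinor bundle $\mathcal{S}$. Any section $\phi$ of $\mathcal{S}$ satisfying the Dirac equation $$D\phi=\boldsymbol{\rho}\,\phi,$$ where $\boldsymbol{\rho}:F\to\mathbb{R}$ is a real-valued function, gives rise to a face-edge-constraint net, with hyperedges $E_{ij}$ and normals $n_i$, by $$E_{ij}=\langle\phi_i,\,e_{ij}\cdot\tilde\eta_{ji}(\phi_j)\rangle,\qquad n_i=\frac1{|\phi_i|^2}\langle\phi_i,\mathbf{k}\cdot\phi_i\rangle .$$
   Context: $\mathbb{H}$ is the algebra of quaternions with units $\mathbf{i},\mathbf{j},\mathbf{k}$; $\mathbb{R}^3=\mathrm{Im}(\mathbb{H})$; $\mathrm{Spin}(2)=\{\cos a+\sin a\,\mathbf{k}\}$. Oriented net: a net $X=(V,E,F)$ is a cell complex whose faces are polygons and in which two adjacent faces share exactly one edge. It is oriented if in every face a direction is chosen for every edge so that the common edge of two adjacent faces has reversed directions in them. Intrinsic net: an oriented net in which each face $\Delta_i$ is endowed with a Euclidean affine plane $\mathrm{Affine}(\Delta_i)$, and every oriented edge $e_{ij}$ of $\Delta_i$ (shared with $\Delta_j$) is identified with a tangent vector $e^i_{ij}$ (a vector attached to a point) of that plane, such that the common edge has the same length in the two neighbouring faces and, for each face, the extension lines of its vectors form a convex polygon with counterclockwise orientation. The vectors of a face need not form a closed polygon. Frames, spinor connection, spinor bundle: choose an oriented orthonormal frame at each face; then $e^i_{ij}$ becomes $\mathfrak{e}^i_{ij}\in\mathrm{span}\{\mathbf{i},\mathbf{j}\}$,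 and $\mathfrak{e}^j_{ij}:=-\mathfrak{e}^j_{ji}$. A spinor connection (lifting) is a choice of $g_{ij}\in\mathrm{Spin}(2)$ for all ordered adjacent pairs with $g_{ji}=g_{ij}^{-1}$ and $\mathfrak{e}^j_{ij}=g_{ij}^{-1}\mathfrak{e}^i_{ij}g_{ij}$; for each edge there are exactly two choices, differing by sign. In these frames a section of the spinor bundle is a map $\phi:F\to\mathbb{H}$, parallel transport from $\Delta_j$ to $\Delta_i$ is $\tilde\eta_{ji}(\phi_j)=g_{ij}\phi_j$, Clifford multiplication is left quaternion multiplication, and $\langle x_1,x_2\rangle=\overline{x_1}\cdot x_2$. So in frames $E_{ij}=\overline{\phi_i}\cdot\mathfrak{e}^i_{ij}\cdot g_{ij}\cdot\phi_j$ and $n_i=\phi_i^{-1}\cdot\mathbf{k}\cdot\phi_i$. The discrete intrinsic Dirac operator is $(D\phi)_i=\tfrac12\sum_j e_{ij}\cdot\tilde\eta_{ji}(\phi_j)=\tfrac12\sum_j\mathfrak{e}^i_{ij}\,g_{ij}\,\phi_j$, the sum being over the faces adjacent to $\Delta_i$. Face-edge-constraint net: an oriented net with $f:V\to\mathbb{R}^3$ and $n:F\to\mathbb{S}^2$ such that $n_i+n_j\perp df_{ij}$ for all adjacent faces, where $df_{ij}$ is the edge vector of the common edge with its orientation in $\Delta_i$. Its dihedral angle $\theta_{ij}$ is the angle from the plane $\mathrm{span}\{n_i,df_{ij}\}$ to the plane $\mathrm{span}\{n_j,df_{ij}\}$, i.e. the angle in $(-\pi,\pi)$ of the right-handed rotation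 about $df_{ij}$ taking the half-plane $\mathbb{R}\,df_{ij}+\mathbb{R}_{>0}n_i$ to $\mathbb{R}\,df_{ij}+\mathbb{R}_{>0}n_j$. Its hyperedge is the quaternion $E_{ij}=|df_{ij}|\tan\frac{\theta_{ij}}2+df_{ij}$, whose imaginary part is the edge vector.
   Formalization: The section φ is assumed nowhere zero; the net is realized on simply connected coverings of X (on X itself if simply connected), since periods can obstruct f; where df_ij is zero or parallel to n_i, so no dihedral angle exists, only Im E_ij = df_ij and the constraint are claimed. *)

(* Defs.v *)
From HB Require Import structures.
From mathcomp Require Import all_boot all_order all_algebra.
From mathcomp Require Import ring lra.
From mathcomp Require Import boolp classical_sets reals trigo.

Set Implicit Arguments.
Unset Strict Implicit.
Unset Printing Implicit Defensive.

Import Order.TTheory GRing.Theory Num.Theory.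

Local Open Scope ring_scope.

Record quat (R : realType) := Quat { qre : R; qi : R; qj : R; qk : R }.

Definition quat_tuple (R : realType) (q : quat R) : R * R * R * R :=
  (qre q, qi q, qj q, qk q).
Definition tuple_quat (R : realType) (t : R * R * R * R) : quat R :=
  Quat t.1.1.1 t.1.1.2 t.1.2 t.2.

Lemma quat_tupleK (R : realType) :
  cancel (@quat_tuple R) (@tuple_quat R).
Proof. by case. Qed.

HB.instance Definition _ (R : realType) :=
  Choice.copy (quat R) (can_type (@quat_tupleK R)).

Definition addq (R : realType) (p q : quat R) : quat R :=
  Quat (qre p + qre q) (qi p + qi q) (qj p + qj q) (qk p + qk q).
Definition oppq (R : realType) (q : quat R) : quat R :=
  Quat (- qre q) (- qi q) (- qj q) (- qk q).
Definition mulq (R : realType) (p q : quat R) : quat R :=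
  Quat (qre p * qre q - qi p * qi q - qj p * qj q - qk p * qk q)
       (qre p * qi q + qi p * qre q + qj p * qk q - qk p * qj q)
       (qre p * qj q - qi p * qk q + qj p * qre q + qk p * qi q)
       (qre p * qk q + qi p * qj q - qj p * qi q + qk p * qre q).
Definition scaleq (R : realType) (a : R) (q : quat R) : quat R :=
  Quat (a * qre q) (a * qi q) (a * qj q) (a * qk q).

Lemma addqA (R : realType) : associative (@addq R).
Proof. by move=> p q r; rewrite /addq /= !addrA. Qed.
Lemma addqC (R : realType) : commutative (@addq R).
Proof. by move=> [? ? ? ?] [? ? ? ?]; congr Quat => /=; ring. Qed.
Lemma add0q (R : realType) : left_id (Quat 0 0 0 0) (@addq R).
Proof. by move=> [? ? ? ?]; rewrite /addq /= !add0r. Qed.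
Lemma addNq (R : realType) : left_inverse (Quat 0 0 0 0) (@oppq R) (@addq R).
Proof. by move=> [? ? ? ?]; rewrite /addq /= !addNr. Qed.

HB.instance Definition _ (R : realType) :=
  GRing.isZmodule.Build (quat R) (@addqA R) (@addqC R) (@add0q R) (@addNq R).

Lemma mulqA (R : realType) : associative (@mulq R).
Proof. by move=> [? ? ? ?] [? ? ? ?] [? ? ? ?]; congr Quat => /=; ring. Qed.
Lemma mul1q (R : realType) : left_id (Quat 1 0 0 0) (@mulq R).
Proof. by move=> [? ? ? ?]; congr Quat => /=; ring. Qed.
Lemma mulq1 (R : realType) : right_id (Quat 1 0 0 0) (@mulq R).
Proof. by move=> [? ? ? ?]; congr Quat => /=; ring. Qed.
Lemma mulqDl (R : realType) : left_distributive (@mulq R) (@addq R).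
Proof. by move=> [? ? ? ?] [? ? ? ?] [? ? ? ?]; congr Quat => /=; ring. Qed.
Lemma mulqDr (R : realType) : right_distributive (@mulq R) (@addq R).
Proof. by move=> [? ? ? ?] [? ? ? ?] [? ? ? ?]; congr Quat => /=; ring. Qed.
Lemma oneq_neq0 (R : realType) : Quat 1 0 0 0 != 0 :> quat R.
Proof. by apply/eqP => -[] /eqP; rewrite oner_eq0. Qed.

HB.instance Definition _ (R : realType) :=
  GRing.Zmodule_isNzRing.Build (quat R) (@mulqA R) (@mul1q R) (@mulq1 R)
    (@mulqDl R) (@mulqDr R) (@oneq_neq0 R).

Lemma scaleqA (R : realType) (a b : R) (q : quat R) :
  scaleq a (scaleq b q) = scaleq (a * b) q.
Proof. by rewrite /scaleq /= !mulrA. Qed.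
Lemma scale1q (R : realType) : left_id 1 (@scaleq R).
Proof. by move=> [? ? ? ?]; rewrite /scaleq /= !mul1r. Qed.
Lemma scaleqDr (R : realType) : right_distributive (@scaleq R) +%R.
Proof. by move=> a [? ? ? ?] [? ? ? ?]; congr Quat => /=; ring. Qed.
Lemma scaleqDl (R : realType) (q : quat R) : {morph (@scaleq R)^~ q : a b / a + b}.
Proof. by move=> a b; case: q => ? ? ? ?; congr Quat => /=; ring. Qed.

HB.instance Definition _ (R : realType) :=
  GRing.Zmodule_isLmodule.Build R (quat R) (@scaleqA R) (@scale1q R)
    (@scaleqDr R) (@scaleqDl R).

Lemma scaleqAl (R : realType) (a : R) (p q : quat R) :
  a *: (p * q) = (a *: p) * q.
Proof. by case: p q => ? ? ? ? [? ? ? ?]; congr Quat => /=; ring. Qed.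
Lemma scaleqAr (R : realType) (a : R) (p q : quat R) :
  a *: (p * q) = p * (a *: q).
Proof. by case: p q => ? ? ? ? [? ? ? ?]; congr Quat => /=; ring. Qed.

HB.instance Definition _ (R : realType) :=
  GRing.Lmodule_isLalgebra.Build R (quat R) (@scaleqAl R).
HB.instance Definition _ (R : realType) :=
  GRing.Lalgebra_isAlgebra.Build R (quat R) (@scaleqAr R).

Definition qconj (R : realType) (q : quat R) : quat R :=
  Quat (qre q) (- qi q) (- qj q) (- qk q).

Definition qdot (R : realType) (p q : quat R) : R :=
  qre p * qre q + qi p * qi q + qj p * qj q + qk p * qk q.

Definition qnorm (R : realType) (q : quat R) : R := Num.sqrt (qdot q q).

Definition invq (R : realType) (q : quat R) : quat R :=
  (qdot q q)^-1 *: qconj q.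

Lemma qdot_eq0 (R : realType) (q : quat R) : (qdot q q == 0) = (q == 0).
Proof.
apply/eqP/eqP => [|->]; last by rewrite /qdot /= !mulr0 !addr0.
case: q => a b c d; rewrite /qdot /= => h.
have ha := sqr_ge0 a; have hb := sqr_ge0 b.
have hc := sqr_ge0 c; have hd := sqr_ge0 d.
rewrite -!expr2 in h.
by congr Quat; apply/eqP; rewrite -sqrf_eq0; apply/eqP; lra.
Qed.

Lemma mulVq (R : realType) :
  {in [pred q : quat R | q != 0], left_inverse 1 (@invq R) *%R}.
Proof.
move=> q; rewrite inE -qdot_eq0 => q0; rewrite /invq -scaleqAl.
have -> : qconj q * q = qdot q q *: 1.
  by case: q {q0} => ? ? ? ?; congr Quat; rewrite /qdot /=; ring.
by rewrite scalerA mulVf // scale1r.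
Qed.
Lemma mulqV (R : realType) :
  {in [pred q : quat R | q != 0], right_inverse 1 (@invq R) *%R}.
Proof.
move=> q; rewrite inE -qdot_eq0 => q0; rewrite /invq -scaleqAr.
have -> : q * qconj q = qdot q q *: 1.
  by case: q {q0} => ? ? ? ?; congr Quat; rewrite /qdot /=; ring.
by rewrite scalerA mulVf // scale1r.
Qed.
Lemma quat_unitP (R : realType) (p q : quat R) :
  q * p = 1 /\ p * q = 1 -> p \in [pred q : quat R | q != 0].
Proof.
case=> h _; rewrite inE; apply/eqP => p0.
by move/eqP: h; rewrite p0 mulr0 eq_sym oner_eq0.
Qed.
Lemma invq_out (R : realType) :
  {in [predC [pred q : quat R | q != 0]], @invq R =1 id}.
Proof.
move=> q; rewrite !inE negbK => /eqP ->.
by rewrite /invq; congr Quat; rewrite /= ?oppr0 mulr0.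
Qed.

HB.instance Definition _ (R : realType) :=
  GRing.NzRing_hasMulInverse.Build (quat R) (@mulVq R) (@mulqV R)
    (@quat_unitP R) (@invq_out R).

Definition qK (R : realType) : quat R := Quat 0 0 0 1.

(* R^3 is Im(H): its elements are the q : quat R with [imaginary q], and its
   Euclidean inner product and norm are the restrictions of qdot and qnorm. *)
Definition qim (R : realType) (q : quat R) : quat R :=
  Quat 0 (qi q) (qj q) (qk q).
Definition imaginary (R : realType) (q : quat R) : Prop := qre q = 0.

Definition qcross (R : realType) (u v : quat R) : quat R :=
  Quat 0 (qj u * qk v - qk u * qj v) (qk u * qi v - qi u * qk v)
         (qi u * qj v - qj u * qi v).

(* Every edge of a face is shared with exactly one other face and two adjacent
   faces share exactly one edge, so an edge is a pair of adjacent faces and the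
   oriented polygon of a face [i] is the duplicate-free cyclic sequence [nbr i]
   of its adjacent faces: the oriented edge e_ij of [i] is the pair (i, j) with
   [j \in nbr i], it is followed in [i] by e_ij' with j' = next (nbr i) j, and
   it starts at the vertex [tail i j].  Values of [tail i j] for non-adjacent
   faces are irrelevant.  Vertices and faces may be infinite in number. *)
Record oriented_net := OrientedNet {
  vertex : Type;
  face : eqType;
  nbr : face -> seq face;
  tail : face -> face -> vertex;
  nbr_ge3 : forall i, (3 <= size (nbr i))%N;
  nbr_uniq : forall i, uniq (nbr i);
  nbr_irrefl : forall i, i \notin nbr i;
  nbr_sym : forall i j, (j \in nbr i) = (i \in nbr j);
  (* e_ji is e_ij with reversed direction; the equality of the other pair of
     endpoints is this one for (j, i) *)
  tail_rev : forall i j, j \in nbr i -> tail j i = tail i (next (nbr i) j)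
}.

Definition head (X : oriented_net) (i j : face X) : vertex X :=
  tail i (next (nbr i) j).

Fixpoint edge_path (X : oriented_net) (x : vertex X)
    (s : seq (face X * face X)) (y : vertex X) : Prop :=
  if s is (i, j) :: s' then
    [/\ j \in nbr i, tail i j = x & edge_path (head i j) s' y]
  else x = y.

Inductive homotopic (X : oriented_net) (x y : vertex X) :
    seq (face X * face X) -> seq (face X * face X) -> Prop :=
| homotopic_refl s : edge_path x s y -> homotopic x y s s
| homotopic_sym s t : homotopic x y s t -> homotopic x y t s
| homotopic_trans s t u :
    homotopic x y s t -> homotopic x y t u -> homotopic x y s u
| homotopic_backtrack p q i j :
    edge_path x (p ++ [:: (i, j); (j, i)] ++ q) y ->
    homotopic x y (p ++ [:: (i, j); (j, i)] ++ q) (p ++ q)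
| homotopic_face p q i k :
    edge_path x (p ++ [seq (i, j) | j <- rot k (nbr i)] ++ q) y ->
    homotopic x y (p ++ [seq (i, j) | j <- rot k (nbr i)] ++ q) (p ++ q).

(* Every connected component is simply connected. *)
Definition simply_connected (X : oriented_net) : Prop :=
  forall (x : vertex X) s, edge_path x s x -> homotopic x x s [::].

(* Coverings: cell maps which preserve the polygons of the faces and are
   bijective on the oriented edges starting at a vertex.  Edge vectors which
   close up around every face are the differential of a function of the
   vertices only up to periods along the non-contractible loops, so that
   realizations in R^3 live on simply connected coverings (on the net itself,
   through [idcover], when it is simply connected). *)
Record covering (Y X : oriented_net) := Covering {
  cover_face :> face Y -> face X;
  cover_vertex : vertex Y -> vertex X;
  cover_nbr : forall i, exists k,
    [seq cover_face j | j <- nbr i] = rot k (nbr (cover_face i));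
  cover_tail : forall i j, j \in nbr i ->
    cover_vertex (tail i j) = tail (cover_face i) (cover_face j);
  cover_star : forall (y : vertex Y) (i j : face X),
    j \in nbr i -> tail i j = cover_vertex y ->
    exists! d : face Y * face Y,
      [/\ d.2 \in nbr d.1, tail d.1 d.2 = y,
          cover_face d.1 = i & cover_face d.2 = j];
  cover_face_surj : forall i, exists i', cover_face i' = i;
  cover_vertex_surj : forall x, exists y, cover_vertex y = x
}.

Lemma idcover_nbr (X : oriented_net) (i : face X) :
  exists k, [seq id j | j <- nbr i] = rot k (nbr (id i)).
Proof. by exists 0%N; rewrite map_id rot0. Qed.
Lemma idcover_star (X : oriented_net) (y : vertex X) (i j : face X) :
  j \in nbr i -> tail i j = id y ->
  exists! d : face X * face X,
    [/\ d.2 \in nbr d.1, tail d.1 d.2 = y, id d.1 = i & id d.2 = j].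
Proof. by move=> ij ty; exists (i, j); split=> // -[a b] [_ _ /= -> ->]. Qed.

Definition idcover (X : oriented_net) : covering X X :=
  @Covering X X id id (@idcover_nbr X) (fun _ _ _ => erefl)
    (@idcover_star X) (fun i => ex_intro _ i erefl)
    (fun x => ex_intro _ x erefl).

Definition det2 (R : realType) (u v : 'rV[R]_2) : R :=
  u 0 0 * v 0 1 - u 0 1 * v 0 0.

(* The vector with coordinates u in the frame (i, j) of a face. *)
Definition ijvec (R : realType) (u : 'rV[R]_2) : quat R :=
  Quat 0 (u 0 0) (u 0 1) 0.

(* The vectors [e j] attached at [p j], for j in the cyclic sequence s, lie on
   the successive sides of a convex polygon with counterclockwise orientation:
   [q j] is the starting corner of the j-th side, and every corner which is not
   on a side is strictly to the left of that side. *)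
Definition extends_to_convex_ccw (R : realType) (I : eqType) (s : seq I)
    (p e : I -> 'rV[R]_2) : Prop :=
  exists q : I -> 'rV[R]_2,
    (forall j, j \in s -> exists t : R, q j = p j + t *: e j) /\
    (forall j, j \in s ->
       exists2 c : R, 0 < c & q (next s j) - q j = c *: e j) /\
    (forall j m, j \in s -> m \in s -> m != j -> m != next s j ->
       0 < det2 (q (next s j) - q j) (q m - q j)).

(* The Euclidean affine plane of every face is identified with R^2 by an
   oriented orthonormal frame (and an origin): [evec i j] is the vector e^i_ij
   and [ept i j] the point to which it is attached. *)
Record intrinsic_net (R : realType) := IntrinsicNet {
  inet :> oriented_net;
  ept : face inet -> face inet -> 'rV[R]_2;
  evec : face inet -> face inet -> 'rV[R]_2;
  evec_length : forall i j, j \in nbr i ->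
    qnorm (ijvec (evec i j)) = qnorm (ijvec (evec j i));
  evec_convex : forall i,
    extends_to_convex_ccw (nbr i) (ept i) (evec i)
}.

Definition frame_edge (R : realType) (X : intrinsic_net R) (i j : face X) :
  quat R := ijvec (evec i j).

(* The vector e^j_ij is - e^j_ji. *)
Record spinor_connection (R : realType) (X : intrinsic_net R) :=
  SpinorConnection {
  lift :> face X -> face X -> quat R;
  lift_spin2 : forall i j, j \in nbr i ->
    exists a : R, lift i j = Quat (cos a) 0 0 (sin a);
  lift_inv : forall i j, j \in nbr i -> lift j i = (lift i j)^-1;
  lift_levi_civita : forall i j, j \in nbr i ->
    - frame_edge j i = (lift i j)^-1 * frame_edge i j * lift i j
}.

Definition hermitian (R : realType) (x1 x2 : quat R) : quat R := qconj x1 * x2.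

Definition dirac (R : realType) (X : intrinsic_net R)
    (g : spinor_connection X) (phi : face X -> quat R) (i : face X) : quat R :=
  2^-1 *: \sum_(j <- nbr i) frame_edge i j * (g i j * phi j).

Definition spinor_hyperedge (R : realType) (X : intrinsic_net R)
    (g : spinor_connection X) (phi : face X -> quat R) (i j : face X) :
  quat R := hermitian (phi i) (frame_edge i j * (g i j * phi j)).

Definition spinor_normal (R : realType) (X : intrinsic_net R)
    (phi : face X -> quat R) (i : face X) : quat R :=
  (qnorm (phi i) ^+ 2)^-1 *: hermitian (phi i) (qK R * phi i).

Definition edge_vector (R : realType) (X : oriented_net)
    (f : vertex X -> quat R) (i j : face X) : quat R :=
  f (head i j) - f (tail i j).

Definition face_edge_constraint_net (R : realType) (X : oriented_net)
    (f : vertex X -> quat R) (n : face X -> quat R) : Prop :=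
  (forall v, imaginary (f v)) /\
  (forall i, imaginary (n i) /\ qnorm (n i) = 1) /\
  (forall i j, j \in nbr i -> qdot (n i + n j) (edge_vector f i j) = 0).

(* Right-handed, by Rodrigues' formula; meaningful for v != 0. *)
Definition rotation (R : realType) (v : quat R) (theta : R) (x : quat R) :
  quat R :=
  let u := (qnorm v)^-1 *: v in
  cos theta *: x + sin theta *: qcross u x + ((1 - cos theta) * qdot u x) *: u.

Definition half_plane (R : realType) (v n : quat R) : set (quat R) :=
  [set x | exists a b : R, 0 < b /\ x = a *: v + b *: n].

Definition is_dihedral_angle (R : realType) (v n1 n2 : quat R) (theta : R) :
  Prop :=
  - pi < theta < pi /\
  image (half_plane v n1) (rotation v theta) = half_plane v n2.

(* E is the hyperedge of an edge with vector v between faces of normals n1 and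
   n2.  When v and n1 are linearly dependent (in particular when v = 0) they do
   not span a plane and there is no dihedral angle: then only the imaginary
   part of E is determined. *)
Definition is_hyperedge (R : realType) (v n1 n2 E : quat R) : Prop :=
  qim E = v /\
  (qcross v n1 != 0 ->
   exists2 theta : R, is_dihedral_angle v n1 n2 theta &
     E = (qnorm v * tan (theta / 2))%:A + v).

(* Main.v *)
Require Import Defs.
From mathcomp Require Import all_boot all_order all_algebra.
From mathcomp Require Import ring lra.
From mathcomp Require Import boolp classical_sets reals trigo.

Set Implicit Arguments.
Unset Strict Implicit.
Unset Printing Implicit Defensive.

Import Order.TTheory GRing.Theory Num.Theory.

Local Open Scope ring_scope.

(** Write [t = e_ij g_ij] for the frame edge twisted by the connection.  Both
    factors are pinned to planes: [e_ij] lies in span(i, j) and [g_ij] in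
    span(1, k), so [t] lies again in span(i, j).  Hence [t] is imaginary and
    anticommutes with [k], and the Levi-Civita condition says exactly that the
    twisted edge of the reversed edge is [- t].  The theorem follows from these
    three facts about [E_ij = conj(phi_i) t phi_j].

    - Reversal: [E_ji = conj(E_ij)] ([spinor_hyperedge_rev]), so the imaginary
      parts form an antisymmetric function of the oriented edges.
    - Closedness: by the Dirac equation, the sum of the [E_ij] around a face is
      [2 rho_i |phi_i|^2] ([spinor_hyperedge_sum]), a real number, so the
      imaginary parts close up around every face.  On a simply connected net
      such a 1-form is the differential of a function of the vertices
      ([simply_connected_exact]).  A covering preserves the polygons of the
      faces, so this can be applied upstairs.
    - Intertwining: since [n_i conj(phi_i) = conj(phi_i) k] and
      [phi_j n_j = k phi_j], anticommutation gives [n_i E_ij = - E_ij n_j]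
      ([spinor_normal_intertwining]).

    The last identity contains the whole geometry of an edge.  With
    [E = h + v], its real part is the constraint that [n_i + n_j] is orthogonal
    to [v].  Solved for [n_j], it reads [n_j = - E^-1 n_i E].  Conjugation by
    [h + v] is a rotation about [v], and the minus sign makes [n_j], up to a
    multiple of [v], the image of [n_i] under the rotation by the angle
    [theta = 2 atan (h / |v|)]; that is [h = |v| tan (theta / 2)]
    ([intertwining_is_hyperedge]). *)

(** * Quaternions *)

Section Quaternions.
Variable R : realType.
Implicit Types p q : quat R.

Lemma qconjM p q : qconj (p * q) = qconj q * qconj p.
Proof. by case: p q => ? ? ? ? [? ? ? ?]; congr Quat => /=; ring. Qed.

Lemma mulq_conj q : q * qconj q = (qdot q q)%:A.
Proof. by case: q => ? ? ? ?; congr Quat; rewrite /qdot /=; ring. Qed.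

Lemma qconj_mulq q : qconj q * q = (qdot q q)%:A.
Proof. by case: q => ? ? ? ?; congr Quat; rewrite /qdot /=; ring. Qed.

Lemma qim0 : qim 0 = 0 :> quat R.
Proof. by []. Qed.

Lemma qimD p q : qim (p + q) = qim p + qim q.
Proof. by case: p q => ? ? ? ? [? ? ? ?]; congr Quat => /=; ring. Qed.

Lemma qimN q : qim (- q) = - qim q.
Proof. by case: q => ? ? ? ?; congr Quat => /=; ring. Qed.

Lemma qdot_ge0 q : 0 <= qdot q q.
Proof. by rewrite /qdot -!expr2 !addr_ge0 ?sqr_ge0. Qed.

Lemma sqr_qnorm q : qnorm q ^+ 2 = qdot q q.
Proof. by rewrite sqr_sqrtr // qdot_ge0. Qed.

Lemma qnorm_gt0 q : (0 < qnorm q) = (q != 0).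
Proof. by rewrite sqrtr_gt0 lt0r qdot_ge0 qdot_eq0 andbT. Qed.

End Quaternions.

(** * Rotations and dihedral angles *)

Section Rotations.
Variable R : realType.
Implicit Types (n v x y : quat R) (a b theta : R).

Lemma rotationD v theta a b x y :
  rotation v theta (a *: x + b *: y) =
  a *: rotation v theta x + b *: rotation v theta y.
Proof.
rewrite /rotation; set u := _ *: v.
by case: u x y => ? ? ? ? [? ? ? ?] [? ? ? ?]; congr Quat;
   rewrite /qdot /=; ring.
Qed.

Lemma rotation_axis v theta : v != 0 -> rotation v theta v = v.
Proof.
rewrite -qnorm_gt0 /rotation => v0.
have := sqr_qnorm v; move: (qnorm v) v0 => L L0 LE.
have -> : qcross (L^-1 *: v) v = 0.
  by case: v {LE} => ? ? ? ?; congr Quat => /=; ring.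
have -> : qdot (L^-1 *: v) v = L.
  have -> : qdot (L^-1 *: v) v = L^-1 * qdot v v.
    by case: v {LE} => ? ? ? ?; rewrite /qdot /=; ring.
  by rewrite -LE; field; lra.
rewrite scaler0 addr0 scalerA mulfK ?gt_eqF // -scalerDl.
by rewrite addrC subrK scale1r.
Qed.

(** A rotation about [v] fixes [v], so it acts on the half-planes bounded by the
    line of [v], and normals need to be tracked only modulo [v].  The slack [c]
    is there for the normals of adjacent faces: their components along the
    common edge are opposite, so the rotation maps one normal to the other only
    modulo [v]. *)
Lemma rotation_half_plane v theta n1 n2 c : v != 0 ->
  rotation v theta n1 = n2 + c *: v ->
  image (half_plane v n1) (rotation v theta) = half_plane v n2.
Proof.
move=> v0 rot_n1; apply/seteqP; split=> x /=.
- case=> _ [a [b [b0 ->]] <-]; exists (a + b * c), b; split=> //.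
  rewrite rotationD rotation_axis // rot_n1 scalerDr scalerA scalerDl.
  by rewrite -!addrA [b *: n2 + _]addrC.
- case=> a [b [b0 ->]]; exists ((a - b * c) *: v + b *: n1).
    by exists (a - b * c), b.
  rewrite rotationD rotation_axis // rot_n1 scalerDr scalerA addrCA addrC.
  by rewrite -scalerDl subrK.
Qed.

Lemma cos2_atan (t : R) : cos (atan t) ^+ 2 = (1 + t ^+ 2)^-1.
Proof.
by rewrite cos_atan exprVn sqr_sqrtr // addr_ge0 // sqr_ge0.
Qed.

Lemma cos_atan_neq0 (t : R) : cos (atan t) != 0.
Proof. by rewrite -sqrf_eq0 cos2_atan invr_eq0 gt_eqF // ltr_pwDl ?sqr_ge0. Qed.

Lemma sin_atanE (t : R) : sin (atan t) = t * cos (atan t).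
Proof. by rewrite -[t in t * _](atanK t) /tan mulfVK // cos_atan_neq0. Qed.

Lemma cos_atan_double (t : R) :
  cos (atan t *+ 2) = (1 - t ^+ 2) / (1 + t ^+ 2).
Proof.
rewrite cos_mulr2n cos2_atan; field.
by rewrite gt_eqF // ltr_pwDl ?sqr_ge0.
Qed.

Lemma sin_atan_double (t : R) :
  sin (atan t *+ 2) = t *+ 2 / (1 + t ^+ 2).
Proof.
rewrite sin_mulr2n sin_atanE mulrCA -expr2 cos2_atan; field.
by rewrite gt_eqF // ltr_pwDl ?sqr_ge0.
Qed.

(** Parametrizing the angle by [h = |v| tan (theta / 2)] makes the rotation a
    rational function of [v] and [h] in which [|v|] occurs only squared; the
    identities of [intertwining_is_hyperedge] become polynomial ones. *)
Lemma rotation_double_atan v n (h : R) : v != 0 ->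
  rotation v (atan (h / qnorm v) *+ 2) n =
  (qdot v v + h ^+ 2)^-1 *: ((qdot v v - h ^+ 2) *: n + (2 * h) *: qcross v n
    + (2 * h ^+ 2 * qdot v n / qdot v v) *: v).
Proof.
rewrite -qnorm_gt0 => L0.
rewrite /rotation /= cos_atan_double sin_atan_double -sqr_qnorm.
move: (qnorm v) L0 => L L0.
have Lh : L ^+ 2 + h ^+ 2 != 0.
  by rewrite gt_eqF // ltr_wpDr ?sqr_ge0 ?exprn_gt0.
have hL : 1 + (h / L) ^+ 2 != 0 by rewrite gt_eqF // ltr_pwDl ?sqr_ge0.
case: v n => ? ? ? ? [? ? ? ?]; congr Quat; rewrite /qdot /=; field.
all: by rewrite Lh gt_eqF.
Qed.

(** The intertwining relation gives [|E|^2 n2 = - conj(E) n1 E].  For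
    [E = h + v] the right-hand side is
    [(|v|^2 - h^2) n1 + 2 h (v x n1) - 2 (v . n1) v], which is [|E|^2] times the
    image of [n1] under the rotation by [2 atan (h / |v|)], up to a multiple
    of [v]. *)
Lemma intertwining_is_hyperedge (E n1 n2 : quat R) :
  imaginary n1 -> imaginary n2 -> n1 * E = - (E * n2) ->
  is_hyperedge (qim E) n1 n2 E.
Proof.
move=> n1_im n2_im comm; split=> // vn1.
have v0 : qim E != 0.
  apply: contra_neq vn1 => ->.
  by congr Quat => /=; ring.
have L2 := sqr_qnorm (qim E).
set v := qim E in v0 L2 *; set h := qre E.
have n2E : (qdot E E) *: n2 = - (qconj E * (n1 * E)).
  by rewrite comm mulrN opprK mulrA qconj_mulq -scaleqAl mul1r.
exists (atan (h / qnorm v) *+ 2).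
- split.
    have := atan_gtNpi2 (h / qnorm v); have := atan_ltpi2 (h / qnorm v).
    by move: (atan _) => a; lra.
  (* [n1] and [n2] have components [v . n1 / |v|^2] and its opposite along
     [v]: the rotation preserves the former, hence the doubled coefficient. *)
  apply: (@rotation_half_plane _ _ _ _ (2 * qdot v n1 / qnorm v ^+ 2)) => //.
  have N0 : qdot E E != 0.
    by rewrite qdot_eq0; apply: contra_neq v0; rewrite /v => ->.
  have -> : n2 = (qdot E E)^-1 *: - (qconj E * (n1 * E)).
    by rewrite -n2E scalerA mulVf // scale1r.
  rewrite L2 rotation_double_atan //.
  have := v0; rewrite -qdot_eq0 /v /h /qdot.
  move: n1_im N0; rewrite /imaginary /qdot.
  case: n1 {comm vn1 n2E} => n0 n1 n1' n1'' /= ->.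
  case: (E) => e0 e1 e2 e3 /= N0 S0.
  have {}S0 : e1 * e1 + e2 * e2 + e3 * e3 != 0.
    by apply: contra_neq S0 => S0 /=; rewrite -[RHS]S0; ring.
  by congr Quat => /=; field; rewrite S0 N0.
- have -> : atan (h / qnorm v) *+ 2 / 2 = atan (h / qnorm v) by field.
  rewrite atanK mulrC divfK; last by rewrite gt_eqF // qnorm_gt0.
  by rewrite /v /h; case: (E) => ? ? ? ?; congr Quat => /=; ring.
Qed.

(** The real part of the intertwining relation, because the real part of a
    product of imaginary quaternions is minus their inner product. *)
Lemma qdot_intertwining (E n1 n2 : quat R) :
  imaginary n1 -> imaginary n2 -> n1 * E = - (E * n2) ->
  qdot (n1 + n2) (qim E) = 0.
Proof.
rewrite /imaginary; case: E n1 n2 => ? ? ? ? [? ? ? ?] [? ? ? ?] /= -> ->.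
by move=> /(congr1 (@qre R)); rewrite /qdot /= => h; lra.
Qed.

End Rotations.

(** * Closed forms on nets and coverings *)

Section Potentials.
Variables (X : oriented_net) (V : zmodType) (w : face X -> face X -> V).
Implicit Types (x y z : vertex X) (s t : seq (face X * face X)).

Definition path_sum s : V := \sum_(d <- s) w d.1 d.2.

Lemma path_sum_cat s t : path_sum (s ++ t) = path_sum s + path_sum t.
Proof. by rewrite /path_sum big_cat. Qed.

Lemma edge_path_cat x y z s t :
  edge_path x s y -> edge_path y t z -> edge_path x (s ++ t) z.
Proof.
elim: s x => [|[i j] s IHs] x /= => [->|[ij tx sy] tz] //.
by split=> //; apply: IHs.
Qed.

Lemma edge_path_mem x y s d : edge_path x s y -> d \in s -> d.2 \in nbr d.1.
Proof.
elim: s x => [|[i j] s IHs] x //= [ij _ sy]; rewrite inE => /orP[/eqP->|] //.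
exact: IHs sy.
Qed.

Definition reverse_path s := rev [seq (d.2, d.1) | d <- s].

Lemma edge_path_reverse x y s :
  edge_path x s y -> edge_path y (reverse_path s) x.
Proof.
elim: s x => [|[i j] s IHs] x /= => [->|[ij tx sy]] //.
rewrite /reverse_path /= rev_cons -cats1; apply: edge_path_cat (IHs _ sy) _.
have ji : i \in nbr j by rewrite nbr_sym.
by split=> //=; [exact: tail_rev | rewrite /Defs.head -(tail_rev ji)].
Qed.

Hypothesis w_rev : forall i j, j \in nbr i -> w j i = - w i j.
Hypothesis w_closed : forall i, \sum_(j <- nbr i) w i j = 0.

Lemma path_sum_reverse x y s :
  edge_path x s y -> path_sum (reverse_path s) = - path_sum s.
Proof.
move=> sxy; rewrite /path_sum /reverse_path (perm_big _ (permEl (perm_rev _))).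
rewrite big_map /= -sumrN big_seq [RHS]big_seq.
by apply: eq_bigr => d /(edge_path_mem sxy); apply: w_rev.
Qed.

(** Of the elementary homotopies, cancelling a backtrack uses the antisymmetry
    of [w], and sliding over a face uses its closedness. *)
Lemma path_sum_homotopic x y s t :
  homotopic x y s t -> path_sum s = path_sum t.
Proof.
elim=> {s t} [//|//|s t u _ -> _ ->//|p q i j pathE|p q i k _].
- rewrite !path_sum_cat; suff -> : path_sum [:: (i, j); (j, i)] = 0.
    by rewrite add0r.
  have ij : j \in nbr i.
    apply: (edge_path_mem (d := (i, j)) pathE).
    by rewrite mem_cat inE eqxx orbT.
  by rewrite /path_sum !big_cons big_nil /= (w_rev ij) addr0 subrr.
- rewrite !path_sum_cat.
  suff -> : path_sum [seq (i, j) | j <- rot k (nbr i)] = 0.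
    by rewrite add0r.
  by rewrite /path_sum big_map (perm_big _ (permEl (perm_rot _ _))) w_closed.
Qed.

(** The discrete Poincare lemma: integrate along a path from a base point, the
    result being independent of the path because loops are contractible.  A net
    may have many components, so a base point is chosen in each of them, as a
    function of the component only. *)
Lemma simply_connected_exact : simply_connected X ->
  exists f : vertex X -> V,
    forall i j, j \in nbr i -> f (Defs.head i j) - f (tail i j) = w i j.
Proof.
move=> X_sc.
have indep x y s t :
    edge_path x s y -> edge_path x t y -> path_sum s = path_sum t.
  move=> sy ty; have /X_sc := edge_path_cat sy (edge_path_reverse ty).
  move/path_sum_homotopic; rewrite path_sum_cat (path_sum_reverse ty).
  by rewrite {3}/path_sum big_nil => /eqP; rewrite subr_eq0 => /eqP.
(* [linked y] is the component of [y] as a set: adjacent vertices have equal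
   components, hence the same base point. *)
pose linked y := [set x | exists s, edge_path x s y]%classic.
have linkedxx y : linked y y by exists [::].
have linked_edge i j :
    j \in nbr i -> linked (tail i j) = linked (Defs.head i j).
  move=> ij; have e_ij : edge_path (tail i j) [:: (i, j)] (Defs.head i j) by [].
  apply/seteqP; split=> x [s sx].
    by exists (s ++ [:: (i, j)]); apply: edge_path_cat sx e_ij.
  exists (s ++ reverse_path [:: (i, j)]).
  exact: edge_path_cat sx (edge_path_reverse e_ij).
have [x0|no_vertex] := pselect (exists x : vertex X, True); last first.
  by exists (fun=> 0) => i j _; case: no_vertex; exists (tail i j).
pose base (A : set (vertex X)) := xget (sval (cid x0) : {classic vertex X}) A.
have baseP y : linked y (base (linked y)) by apply: xgetPex; exists y.
pose route y := sval (cid (baseP y)).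
have routeP y : edge_path (base (linked y)) (route y) y.
  by rewrite /route; case: cid.
exists (fun y => path_sum (route y)) => i j ij.
have e_ij : edge_path (tail i j) [:: (i, j)] (Defs.head i j) by [].
have := edge_path_cat (routeP (tail i j)) e_ij.
rewrite linked_edge // => /(indep _ _ _ _ (routeP (Defs.head i j))) ->.
by rewrite path_sum_cat addrC addKr /path_sum big_cons big_nil addr0.
Qed.
End Potentials.

Lemma covering_nbr (Y X : oriented_net) (p : covering Y X) (i j : face Y) :
  j \in nbr i -> p j \in nbr (p i).
Proof.
by have [k kE] := cover_nbr p i => /(map_f p); rewrite kE mem_rot.
Qed.

Lemma covering_sum (V : zmodType) (Y X : oriented_net) (p : covering Y X)
    (i : face Y) (F : face X -> V) :
  \sum_(j <- nbr i) F (p j) = \sum_(j <- nbr (p i)) F j.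
Proof.
have [k kE] := cover_nbr p i.
by rewrite -(big_map p xpredT F) kE (perm_big _ (permEl (perm_rot _ _))).
Qed.

(** * Hyperedges and normals of a spinor *)

Section SpinorNet.
Variables (R : realType) (X : intrinsic_net R) (g : spinor_connection X).
Variables (phi : face X -> quat R) (phi_neq0 : forall i, phi i != 0).
Implicit Types i j : face X.

(** The Levi-Civita condition with [g_ji = g_ij^-1] gives
    [e_ji g_ji = - g_ij^-1 e_ij], and moving an element of span(1, k) across an
    element of span(i, j) conjugates it, which turns [g_ij^-1] back into
    [g_ij]. *)
Lemma twisted_edge_rev i j : j \in nbr i ->
  frame_edge j i * g j i = - (frame_edge i j * g i j).
Proof.
move=> ij; have [a ga] := lift_spin2 g ij.
have g0 : g i j * qconj (g i j) = 1.
  rewrite mulq_conj ga /qdot /= !mulr0 !addr0 -!expr2 cos2Dsin2.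
  by rewrite scale1r.
have gV : (g i j)^-1 = qconj (g i j).
  have gu : g i j \is a GRing.unit.
    apply/unitrP; exists (qconj (g i j)); split=> //.
    by rewrite qconj_mulq -mulq_conj.
  by apply: (mulrI gu); rewrite divrr.
rewrite -[frame_edge j i]opprK (lift_levi_civita g ij) (lift_inv g ij) gV.
rewrite mulNr -!mulrA g0 mulr1 ga /frame_edge; congr (- _).
by congr Quat => /=; ring.
Qed.

Lemma qK_twisted_edge i j : j \in nbr i ->
  qK R * (frame_edge i j * g i j) = - (frame_edge i j * g i j * qK R).
Proof.
move=> ij; have [a ->] := lift_spin2 g ij.
by congr Quat => /=; ring.
Qed.

Lemma twisted_edge_imaginary i j : j \in nbr i ->
  qconj (frame_edge i j * g i j) = - (frame_edge i j * g i j).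
Proof.
move=> ij; have [a ->] := lift_spin2 g ij.
by congr Quat => /=; ring.
Qed.

Lemma spinor_hyperedgeE i j :
  spinor_hyperedge g phi i j = qconj (phi i) * (frame_edge i j * g i j) * phi j.
Proof. by rewrite /spinor_hyperedge /Defs.hermitian !mulrA. Qed.

Lemma spinor_hyperedge_rev i j : j \in nbr i ->
  spinor_hyperedge g phi j i = qconj (spinor_hyperedge g phi i j).
Proof.
move=> ij; rewrite !spinor_hyperedgeE twisted_edge_rev //.
have -> q : qconj (qconj (phi i) * q * phi j) = qconj (phi j) * qconj q * phi i.
  rewrite [LHS]qconjM [qconj (qconj _ * q)]qconjM mulrA; congr (_ * _ * _).
  by case: (phi i) => ? ? ? ?; congr Quat; rewrite /= ?opprK.
by rewrite twisted_edge_imaginary.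
Qed.

Lemma spinor_normal_imaginary i : imaginary (spinor_normal phi i).
Proof.
rewrite /imaginary /spinor_normal; move: (_^-1) => c.
by case: (phi i) => ? ? ? ?; rewrite /=; ring.
Qed.

Lemma spinor_normal_conj i :
  spinor_normal phi i * qconj (phi i) = qconj (phi i) * qK R.
Proof.
rewrite /spinor_normal /Defs.hermitian sqr_qnorm -scaleqAl -!mulrA mulq_conj.
by rewrite -!scaleqAr mulr1 scalerA mulVf ?qdot_eq0 // scale1r.
Qed.

Lemma mul_spinor_normal i : phi i * spinor_normal phi i = qK R * phi i.
Proof.
rewrite /spinor_normal /Defs.hermitian sqr_qnorm -scaleqAr mulrA mulq_conj.
by rewrite -!scaleqAl mul1r scalerA mulVf ?qdot_eq0 // scale1r.
Qed.

Lemma spinor_normal_norm i : qnorm (spinor_normal phi i) = 1.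
Proof.
have p0 : qdot (phi i) (phi i) != 0 by rewrite qdot_eq0.
rewrite /qnorm -[RHS]sqrtr1; congr Num.sqrt.
rewrite /spinor_normal /Defs.hermitian sqr_qnorm.
move: p0; case: (phi i) => a b c d; rewrite /qdot /= => p0.
by field.
Qed.

(** Both normals act on [E_ij] as [k] on the twisted edge, from either side,
    and [k] anticommutes with it. *)
Lemma spinor_normal_intertwining i j : j \in nbr i ->
  spinor_normal phi i * spinor_hyperedge g phi i j =
  - (spinor_hyperedge g phi i j * spinor_normal phi j).
Proof.
move=> ij; rewrite spinor_hyperedgeE -[_ * phi j * _]mulrA mul_spinor_normal.
rewrite !mulrA spinor_normal_conj -!mulrA.
rewrite [frame_edge i j * (g i j * phi j)]mulrA.
rewrite [qK R * _]mulrA qK_twisted_edge // !mulNr mulrN !mulrA //.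
Qed.

Lemma spinor_hyperedge_sum (rho : face X -> R) i :
  dirac g phi i = rho i *: phi i ->
  \sum_(j <- nbr i) spinor_hyperedge g phi i j =
  (2 * rho i * qdot (phi i) (phi i))%:A.
Proof.
rewrite /dirac => dirac_eq.
rewrite /spinor_hyperedge /Defs.hermitian -mulr_sumr.
have -> : \sum_(j <- nbr i) frame_edge i j * (g i j * phi j) =
    (2 * rho i) *: phi i.
  by rewrite -scalerA -dirac_eq scalerA mulfV ?scale1r // pnatr_eq0.
by rewrite -scaleqAr qconj_mulq scalerA.
Qed.
End SpinorNet.

Theorem theorem5p8 (R : realType) (X : intrinsic_net R)
    (g : spinor_connection X) (phi : face X -> quat R) (rho : face X -> R)
    (phi_neq0 : forall i, phi i != 0)
    (dirac_eq : forall i, dirac g phi i = rho i *: phi i)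
    (Y : oriented_net) (p : covering Y X) (Y_sc : simply_connected Y) :
  exists f : vertex Y -> quat R,
    face_edge_constraint_net f (fun i => spinor_normal phi (p i)) /\
    (forall i j : face Y, j \in nbr i ->
       is_hyperedge (edge_vector f i j)
         (spinor_normal phi (p i)) (spinor_normal phi (p j))
         (spinor_hyperedge g phi (p i) (p j))).
Proof.
pose w (i j : face Y) := qim (spinor_hyperedge g phi (p i) (p j)).
have w_rev i j : j \in nbr i -> w j i = - w i j.
  move=> /(covering_nbr p) ij; rewrite /w spinor_hyperedge_rev //.
  by case: spinor_hyperedge => ? ? ? ?; congr Quat; rewrite /= oppr0.
have w_closed i : \sum_(j <- nbr i) w i j = 0.
  rewrite /w -(big_morph _ (@qimD R) (@qim0 R)).
  rewrite (covering_sum p i (spinor_hyperedge g phi (p i))).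
  by rewrite (spinor_hyperedge_sum (dirac_eq _)); congr Quat; rewrite /= mulr0.
have [f0 f0E] := simply_connected_exact w_rev w_closed Y_sc.
(* The values of [f0] need not be imaginary, only its differential is;
   projecting to the imaginary part does not change the differential. *)
exists (fun x => qim (f0 x)).
have dfE i j : j \in nbr i -> edge_vector (fun x => qim (f0 x)) i j = w i j.
  by move=> ij; rewrite /edge_vector /= -qimN -qimD f0E.
have inter i j (ij : j \in nbr i) :=
  spinor_normal_intertwining g phi_neq0 (covering_nbr p ij).
have n_im i := spinor_normal_imaginary phi (p i).
split; [split; [|split] => // i|] => [|j ij|i j ij].
- by split=> //; apply: spinor_normal_norm.
- by rewrite dfE //; apply: qdot_intertwining => //; apply: inter.
- by rewrite dfE //; apply: intertwining_is_hyperedge => //; apply: inter.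
Qed.
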